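(* Let $T$ be an endofunctor on $\textbf{SFuzzy-Top}$ and $\Sigma$ a characteristic fuzzy geometric modal signature for $T$. If states $b\in B$ and $b_1\in B_1$ of fuzzy geometric models $(B,\gamma,\mathcal{V}_B)$ and $(B_1,\gamma_1,\mathcal{V}_{B_1})$ for $T$ are modally equivalent (i.e. $gr(b\models\alpha)=gr(b_1\models\alpha)$ for all $\alpha\in\textbf{FGML}(\Sigma)$), then they are behaviourally equivalent.
   Context: $\textbf{SFuzzy-Top}$: sober fuzzy topological spaces and fuzzy continuous maps. A fuzzy topological space $(S,\tau)$ has $\tau$ a family of maps $S\to[0,1]$ containing constants $0,1$, closed under finite pointwise minima and arbitrary suprema; it is sober if $s\mapsto(\tilde\phi\mapsto\tilde\phi(s))$ is a bijection onto the set of frame homomorphisms $\tau\to[0,1]$. $\mathcal{Q}(S)=\tau_S$, $\mathcal{Q}(f)=f^{-1}:\mu\mapsto\mu\circ f$. An $n$-ary fuzzy-open predicate lifting is a natural transformation $\lambda:\mathcal{Q}^n\to\mathcal{Q}\circ T$ ($\lambda_S(\mu_1\circ f,\dots,\mu_n\circ f)=\lambda_K(\mu_1,\dots,\mu_n)\circ Tf$). $\Sigma$ is characteristic if for each $S$, $\{\lambda_S(\mu_1,\dots,\mu_n):\lambda\in\Sigma,\mu_i\in\mathcal{Q}(S)\}$ is a subbasis for the topology of $TS$. Formulas over propositional variables $\Phi$: $\beta::=\top\mid p\mid\beta_1\wedge\beta_2\mid\bigvee_{j\in J}\beta_j\mid\heartsuit^\lambda(\beta_1,\dots,\beta_n)$.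 A fuzzy geometric model is $(B,\gamma,\mathcal{V}_B)$, $\gamma:B\to TB$ a morphism, $\mathcal{V}_B:\Phi\to\mathcal{Q}(B)$; semantics $[[\top]]=1$, $[[p]]=\mathcal{V}_B(p)$, $\wedge,\bigvee$ pointwise, $[[\heartsuit^\lambda(\alpha_1,\dots,\alpha_n)]](b)=\lambda_B([[\alpha_1]],\dots,[[\alpha_n]])(\gamma(b))$, $gr(b\models\alpha)=[[\alpha]](b)$. A morphism of models is a morphism $f$ with $Tf\circ\sigma_1=\sigma_2\circ f$ and $\mathcal{V}_K(p)\circ f=\mathcal{V}_S(p)$. States $b\in B$, $b_1\in B_1$ are behaviourally equivalent if there are a fuzzy geometric model $\mathcal{C}$ for $T$ and model morphisms $g:\mathcal{B}\to\mathcal{C}$, $h:\mathcal{B}_1\to\mathcal{C}$ with $g(b)=h(b_1)$. *)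

(* Defs.v *)
From mathcomp Require Import all_boot all_order all_algebra.
From mathcomp Require Import boolp classical_sets functions reals.
From mathcomp Require Import interval_inference.

Set Implicit Arguments.
Unset Strict Implicit.
Unset Printing Implicit Defensive.

Import Order.TTheory GRing.Theory Num.Theory.

Local Open Scope classical_set_scope.
Local Open Scope ring_scope.

(* [sup set0 = 0] in a [realType], so the real supremum of a subset of [0, 1]
   is its supremum in the complete lattice [0, 1], also for the empty set. *)
Lemma i01_sup_ge0 (R : realType) (A : set {i01 R}) :
  0 <= sup [set x%:num | x in A].
Proof.
have [->|] := eqVneq A set0; first by rewrite image_set0 sup0.
move=> /set0P [x Ax]; apply: (@le_trans _ _ x%:num) => //.
by apply: ub_le_sup; [exists 1 => _ [y _ <-] | exists x].
Qed.

Lemma i01_sup_le1 (R : realType) (A : set {i01 R}) :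
  sup [set x%:num | x in A] <= 1.
Proof.
have [->|] := eqVneq A set0; first by rewrite image_set0 sup0.
move=> /set0P [x Ax]; apply: ge_sup; first by exists x%:num, x.
by move=> _ [y _ <-].
Qed.

Definition i01_sup (R : realType) (A : set {i01 R}) : {i01 R} :=
  Itv01 (i01_sup_ge0 A) (i01_sup_le1 A).

Section FuzzySets.
Context {R : realType} {X : Type}.

Definition fuzzy_min (mu nu : X -> {i01 R}) : X -> {i01 R} :=
  fun x => Order.min (mu x) (nu x).

Definition fuzzy_sup (A : set (X -> {i01 R})) : X -> {i01 R} :=
  fun x => i01_sup [set mu x | mu in A].

Record is_fuzzy_topology (tau : set (X -> {i01 R})) : Prop := IsFuzzyTopology {
  fuzzy_topology0 : tau (cst 0%:i01);
  fuzzy_topology1 : tau (cst 1%:i01);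
  fuzzy_topology_min : forall mu nu, tau mu -> tau nu -> tau (fuzzy_min mu nu);
  fuzzy_topology_sup : forall A, A `<=` tau -> tau (fuzzy_sup A) }.

Definition is_subbasis (G tau : set (X -> {i01 R})) : Prop :=
  tau = smallest is_fuzzy_topology G.

End FuzzySets.

Record fuzzy_space (R : realType) := FuzzySpace {
  fuzzy_carrier :> Type;
  fuzzy_open : set (fuzzy_carrier -> {i01 R});
  fuzzy_openP : is_fuzzy_topology fuzzy_open }.

(* The frame $\tau_S$. *)
Record opens (R : realType) (S : fuzzy_space R) := MkOpen {
  open_fun :> S -> {i01 R};
  open_funP : fuzzy_open open_fun }.

Section Opens.
Context {R : realType} {S : fuzzy_space R}.
Implicit Types (mu nu : opens S) (A : set (opens S)).

Definition open_top : opens S :=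
  MkOpen (fuzzy_topology1 (fuzzy_openP S)).

Definition open_meet mu nu : opens S :=
  MkOpen (fuzzy_topology_min (fuzzy_openP S) (open_funP mu) (open_funP nu)).

Lemma open_fun_image A : @open_fun R S @` A `<=` @fuzzy_open R S.
Proof. by move=> _ [mu _ <-]; exact: open_funP. Qed.

Definition open_join A : opens S :=
  MkOpen (fuzzy_topology_sup (fuzzy_openP S) (@open_fun_image A)).

(* Frame homomorphisms $\tau_S \to [0, 1]$; bottom is the empty join. *)
Record frame_hom (p : opens S -> {i01 R}) : Prop := FrameHom {
  frame_hom_top : p open_top = 1%:i01;
  frame_hom_meet : forall mu nu, p (open_meet mu nu) = Order.min (p mu) (p nu);
  frame_hom_join : forall A, p (open_join A) = i01_sup (p @` A) }.

Definition point_eval (s : S) : opens S -> {i01 R} := fun mu => mu s.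

End Opens.

Definition sober (R : realType) (S : fuzzy_space R) : Prop :=
  set_bij setT [set p | frame_hom p] (@point_eval R S).

Record sober_space (R : realType) := SoberSpace {
  sober_fuzzy :> fuzzy_space R;
  soberP : sober sober_fuzzy }.

Record fuzzy_hom (R : realType) (S K : fuzzy_space R) := FuzzyHom {
  hom_fun :> S -> K;
  hom_continuous : forall mu, fuzzy_open mu -> fuzzy_open (mu \o hom_fun) }.

Definition hom_id (R : realType) (S : fuzzy_space R) : fuzzy_hom S S :=
  @FuzzyHom R S S (fun x => x) (fun mu mo => mo).

Definition hom_comp (R : realType) (S K L : fuzzy_space R)
    (g : fuzzy_hom K L) (f : fuzzy_hom S K) : fuzzy_hom S L :=
  @FuzzyHom R S L (g \o f)
    (fun mu mo => hom_continuous f (hom_continuous g mo)).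

(* $\mathcal{Q}(f) = f^{-1}$. *)
Definition pullback (R : realType) (S K : fuzzy_space R) (f : fuzzy_hom S K)
    (mu : opens K) : opens S :=
  MkOpen (hom_continuous f (open_funP mu)).

Record endofunctor (R : realType) := Endofunctor {
  fobj :> sober_space R -> sober_space R;
  fmap : forall S K : sober_space R, fuzzy_hom S K -> fuzzy_hom (fobj S) (fobj K);
  fmap_id : forall S : sober_space R, fmap (hom_id S) = hom_id (fobj S);
  fmap_comp : forall (S K L : sober_space R)
      (g : fuzzy_hom K L) (f : fuzzy_hom S K),
    fmap (hom_comp g f) = hom_comp (fmap g) (fmap f) }.

Record predicate_lifting (R : realType) (T : endofunctor R) (n : nat) :=
  PredicateLifting {
    lifting :> forall S : sober_space R, ('I_n -> opens S) -> opens (T S);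
    lifting_natural : forall (S K : sober_space R) (f : fuzzy_hom S K)
        (mu : 'I_n -> opens K),
      lifting (fun i => pullback f (mu i)) = pullback (fmap T f) (lifting mu) }.

Definition signature (R : realType) (T : endofunctor R) : Type :=
  forall n : nat, predicate_lifting T n -> Prop.

Definition characteristic (R : realType) (T : endofunctor R)
    (Sigma : signature T) : Prop :=
  forall S : sober_space R,
    is_subbasis
      [set nu : T S -> {i01 R} |
        exists (n : nat) (lambda : predicate_lifting T n) (mu : 'I_n -> opens S),
          Sigma n lambda /\ nu = lambda S mu]
      (@fuzzy_open R (T S)).

Inductive formula (R : realType) (T : endofunctor R) (Sigma : signature T)
    (Phi : Type) : Type :=
  | FTop
  | FVar of Phi
  | FAnd of formula Sigma Phi & formula Sigma Phi
  | FOr (J : Type) of J -> formula Sigma Phi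
  | FModal (n : nat) (lambda : predicate_lifting T n) of Sigma n lambda &
      'I_n -> formula Sigma Phi.

Record fuzzy_model (R : realType) (T : endofunctor R) (Phi : Type) :=
  FuzzyModel {
    states :> sober_space R;
    transition : fuzzy_hom states (T states);
    valuation : Phi -> opens states }.

Fixpoint semantics (R : realType) (T : endofunctor R) (Sigma : signature T)
    (Phi : Type) (B : fuzzy_model T Phi) (alpha : formula Sigma Phi) : opens B :=
  match alpha with
  | FTop => open_top
  | FVar p => valuation B p
  | FAnd a1 a2 => open_meet (semantics B a1) (semantics B a2)
  | FOr J a => open_join [set semantics B (a j) | j in [set: J]]
  | FModal n lambda _ a =>
      pullback (transition B) (lambda B (fun i => semantics B (a i)))
  end.

Definition grade (R : realType) (T : endofunctor R) (Sigma : signature T)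
    (Phi : Type) (B : fuzzy_model T Phi) (b : B) (alpha : formula Sigma Phi) :
    {i01 R} :=
  semantics B alpha b.

Definition modally_equivalent (R : realType) (T : endofunctor R)
    (Sigma : signature T) (Phi : Type) (B B1 : fuzzy_model T Phi)
    (b : B) (b1 : B1) : Prop :=
  forall alpha : formula Sigma Phi, grade b alpha = grade b1 alpha.

Record model_hom (R : realType) (T : endofunctor R) (Phi : Type)
    (S K : fuzzy_model T Phi) := ModelHom {
  model_fun :> fuzzy_hom S K;
  model_fun_transition :
    hom_comp (fmap T model_fun) (transition S)
    = hom_comp (transition K) model_fun;
  model_fun_valuation : forall p : Phi,
    pullback model_fun (valuation K p) = valuation S p }.

Definition behaviourally_equivalent (R : realType) (T : endofunctor R)
    (Phi : Type) (B B1 : fuzzy_model T Phi) (b : B) (b1 : B1) : Prop :=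
  exists (C : fuzzy_model T Phi) (g : model_hom B C) (h : model_hom B1 C),
    g b = h b1.

(* Main.v *)
Require Import Defs.
From mathcomp Require Import all_boot all_order all_algebra.
From mathcomp Require Import boolp classical_sets functions reals.
From mathcomp Require Import interval_inference.

(** The grades of formulas, evaluated simultaneously in both models, form a
    fuzzy topology on the disjoint union of the two state sets.  Let [Z] be the
    sobrification of this space, with the canonical maps [g : B -> Z] and
    [h : B1 -> Z]; modally equivalent states have the same image.  As [Sigma] is
    characteristic, the copairing of [T g \o gamma] and [T h \o gamma1] is
    continuous: a subbasic open of [T Z] pulls back to the grade of a modal
    formula.  Since [T Z] is sober, the copairing extends along the
    sobrification to a transition map [Z -> T Z]. *)

Set Implicit Arguments.
Unset Strict Implicit.
Unset Printing Implicit Defensive.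

Local Open Scope classical_set_scope.
Local Open Scope ring_scope.

Section FuzzySpaces.
Context {R : realType}.
Implicit Types S K : fuzzy_space R.

Lemma fuzzy_sup0 (X : Type) : fuzzy_sup set0 = cst 0%:i01 :> (X -> {i01 R}).
Proof.
apply/funext => x; rewrite /fuzzy_sup image_set0.
by apply/val_inj; rewrite /= image_set0 sup0.
Qed.

Lemma open_funI S : injective (@open_fun R S).
Proof.
case=> f fo [g go] /= fg; subst g; congr MkOpen; exact: Prop_irrelevance.
Qed.

Lemma hom_funI S K : injective (@hom_fun R S K).
Proof.
case=> f fc [g gc] /= fg; subst g; congr FuzzyHom; exact: Prop_irrelevance.
Qed.

Lemma fuzzy_sup_comp (X Y : Type) (f : X -> Y) (A : set (Y -> {i01 R})) :
  fuzzy_sup A \o f = fuzzy_sup ((fun mu => mu \o f) @` A).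
Proof. by apply/funext => x; rewrite /fuzzy_sup /= image_comp. Qed.

Lemma final_fuzzy_topology S (Y : Type) (f : S -> Y) :
  is_fuzzy_topology [set mu : Y -> {i01 R} | fuzzy_open (mu \o f)].
Proof.
split => /=.
- exact: (fuzzy_topology0 (fuzzy_openP S)).
- exact: (fuzzy_topology1 (fuzzy_openP S)).
- by move=> mu nu; exact: (fuzzy_topology_min (fuzzy_openP S)).
- move=> A Ao; rewrite fuzzy_sup_comp.
  by apply: (fuzzy_topology_sup (fuzzy_openP S)) => _ [mu /Ao ? <-].
Qed.

(** The fuzzy sets on [K] with open pullback along [f] form the final fuzzy topology. It contains
    [G], hence also the smallest fuzzy topology containing [G]. *)
Lemma subbasis_continuous S K (G : set (K -> {i01 R})) (f : S -> K) :
  is_subbasis G (@fuzzy_open R K) ->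
  (forall mu, G mu -> fuzzy_open (mu \o f)) ->
  forall mu, fuzzy_open mu -> fuzzy_open (mu \o f).
Proof.
move=> -> Gf.
exact: (smallest_sub (final_fuzzy_topology f)).
Qed.

Lemma point_eval_frame_hom S (s : S) : frame_hom (point_eval s).
Proof.
split=> // A; rewrite /point_eval /= /fuzzy_sup.
by congr i01_sup; rewrite image_comp.
Qed.

Lemma pullback_frame_hom S K (f : fuzzy_hom S K) (p : opens S -> {i01 R}) :
  frame_hom p -> frame_hom (p \o pullback f).
Proof.
case=> pT pM pJ; split=> /=.
- by rewrite -pT; congr p; exact: open_funI.
- by move=> mu nu; rewrite -pM; congr p; exact: open_funI.
- move=> A; rewrite -image_comp -pJ; congr p; apply: open_funI => /=.
  rewrite fuzzy_sup_comp; congr fuzzy_sup.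
  by rewrite !image_comp.
Qed.

End FuzzySpaces.

Section Sobrification.
Context {R : realType} (S : fuzzy_space R).

(** The spectrum of the frame of opens of [S]. *)
Definition frame_point : Type := {p : opens S -> {i01 R} | frame_hom p}.

Definition frame_eval (mu : opens S) : frame_point -> {i01 R} :=
  fun z => sval z mu.

(** Points are frame homomorphisms, so evaluation commutes with joins. Joining over the whole
    preimage of [A] avoids choosing an open for each member of [A]. *)
Lemma frame_eval_sup (A : set (frame_point -> {i01 R})) :
  A `<=` range frame_eval ->
  fuzzy_sup A = frame_eval (open_join (frame_eval @^-1` A)).
Proof.
move=> Ar; apply/funext => z.
rewrite /frame_eval (frame_hom_join (svalP z)) /fuzzy_sup; congr i01_sup.
apply/seteqP; split => [_ [mu Amu <-]|_ [mu Amu <-]].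
- by have [nu _ nuE] := Ar _ Amu; exists nu; rewrite -?nuE // in Amu *.
- by exists (frame_eval mu).
Qed.

Lemma frame_eval_topology : is_fuzzy_topology (range frame_eval).
Proof.
have supR A : A `<=` range frame_eval -> range frame_eval (fuzzy_sup A).
  by move=> /frame_eval_sup ->; exists (open_join (frame_eval @^-1` A)).
split=> //.
- by rewrite -fuzzy_sup0; exact: supR.
- exists open_top => //.
  by apply: funext => z; exact: (frame_hom_top (svalP z)).
- move=> _ _ [mu _ <-] [nu _ <-]; exists (open_meet mu nu) => //.
  by apply/funext => z; exact: (frame_hom_meet (svalP z)).
Qed.

Definition frame_point_space : fuzzy_space R := FuzzySpace frame_eval_topology.

Definition unit_fun (s : S) : frame_point_space :=
  exist _ (point_eval s) (point_eval_frame_hom s).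

Lemma unit_continuous (mu : frame_point_space -> {i01 R}) :
  fuzzy_open mu -> fuzzy_open (mu \o unit_fun).
Proof. by case=> nu _ <-; exact: open_funP. Qed.

Definition unit_hom : fuzzy_hom S frame_point_space :=
  FuzzyHom unit_continuous.

Definition frame_open (mu : opens S) : opens frame_point_space :=
  @MkOpen R frame_point_space (frame_eval mu) (imageT frame_eval mu).

(** Together with [frame_openK], this makes the frames of opens of [S] and of its spectrum
    isomorphic. *)
Lemma pullback_unitK : cancel (pullback unit_hom) frame_open.
Proof.
move=> nu; apply: open_funI; have [mu _ muE] := open_funP nu.
by rewrite -muE /=; congr frame_eval; apply: open_funI; rewrite /= -muE.
Qed.

Lemma frame_openK : cancel frame_open (pullback unit_hom).
Proof. by move=> mu; apply: open_funI. Qed.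

(** Pulling back along the unit preserves top, meets and joins pointwise, so its inverse
    [frame_open] preserves them too. *)
Lemma frame_hom_frame_open (P : opens frame_point_space -> {i01 R}) :
  frame_hom P -> frame_hom (P \o frame_open).
Proof.
case=> PT PM PJ; split => /=.
- by rewrite -PT; congr P; rewrite -[RHS]pullback_unitK; congr frame_open;
    exact: open_funI.
- move=> mu nu; rewrite -PM; congr P; rewrite -[RHS]pullback_unitK.
  by congr frame_open; exact: open_funI.
- move=> A; rewrite -image_comp -PJ; congr P; rewrite -[RHS]pullback_unitK.
  congr frame_open; apply: open_funI => /=.
  by rewrite fuzzy_sup_comp; congr fuzzy_sup; rewrite !image_comp.
Qed.

Lemma frame_point_space_sober : sober frame_point_space.
Proof.
split.
- by move=> z _; exact: point_eval_frame_hom.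
- move=> [p pf] [q qf] _ _ pq; apply: eq_exist => /=.
  by apply/funext => mu; exact: (congr1 (@^~ (frame_open mu)) pq).
(* [P] is evaluation at the point [P \o frame_open], because every open of the spectrum has the form
   [frame_open mu]. *)
- move=> P Pf; exists (exist _ _ (frame_hom_frame_open Pf)) => //.
  by apply/funext => nu; rewrite -[nu]pullback_unitK.
Qed.

Definition sobrification : sober_space R := SoberSpace frame_point_space_sober.

(** Composing a point [z] with [pullback f] gives a frame homomorphism on the opens of [K]. By
    sobriety it is evaluation at a point of [K], which is the value of the extension at [z]. For [z]
    the image of [s], injectivity of evaluation identifies that value with [f s]. *)
Lemma sobrification_lift (K : sober_space R) (f : fuzzy_hom S K) :
  exists f' : fuzzy_hom sobrification K, hom_comp f' unit_hom = f.
Proof.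
have [_ evI evS] := soberP K.
have /choice [k kE] (z : sobrification) :
    exists y : K, point_eval y = sval z \o pullback f.
  by have [y _ <-] := evS _ (pullback_frame_hom f (svalP z)); exists y.
have k_open mu : fuzzy_open mu -> fuzzy_open (mu \o k).
  move=> muo; exists (pullback f (MkOpen muo)) => //.
  by apply/funext => z; exact: esym (congr1 (@^~ (MkOpen muo)) (kE z)).
exists (FuzzyHom k_open); apply: hom_funI; apply/funext => s /=.
by apply: evI; rewrite ?inE // kE.
Qed.

End Sobrification.

Section LogicalSpace.
Context {R : realType} {T : endofunctor R} (Sigma : signature T) {Phi : Type}.
Context (B B1 : fuzzy_model T Phi).

Definition joint_grade (alpha : formula Sigma Phi) (x : B + B1) : {i01 R} :=
  match x with inl b => grade b alpha | inr b1 => grade b1 alpha end.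

Lemma joint_grade_or (J : Type) (a : J -> formula Sigma Phi) :
  joint_grade (FOr a) = fuzzy_sup [set joint_grade (a j) | j in [set: J]].
Proof.
apply/funext => x; rewrite /fuzzy_sup image_comp.
by case: x => x /=; rewrite /grade /= /fuzzy_sup !image_comp.
Qed.

(* Not [range joint_grade]: the type of formulas lives in too large a universe
   to be the source of an [image]. *)
Definition joint_open (mu : B + B1 -> {i01 R}) : Prop :=
  exists alpha, joint_grade alpha = mu.

Lemma joint_grade_topology : is_fuzzy_topology joint_open.
Proof.
have supR (A : set (B + B1 -> {i01 R})) :
    A `<=` joint_open -> joint_open (fuzzy_sup A).
  move=> Ar.
  (* Choose a formula for each member of [A]; the disjunction indexed by the subtype of [A] then has
     grade [fuzzy_sup A]. *)
  have /choice [a aE] (mu : {mu | A mu}) :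
      exists alpha, joint_grade alpha = sval mu.
    exact: Ar (svalP mu).
  exists (FOr a); rewrite joint_grade_or; congr fuzzy_sup.
  apply/seteqP; split => [_ [mu _ <-]|mu Amu] /=.
    by rewrite aE; exact: svalP.
  by exists (exist _ mu Amu) => //; rewrite /= aE.
split=> //.
- by rewrite -fuzzy_sup0; exact: supR.
- by exists (@FTop _ _ _ _); apply/funext => -[].
- move=> _ _ [a <-] [a' <-]; exists (FAnd a a').
  by apply/funext => -[].
Qed.

Definition logical_space : fuzzy_space R := FuzzySpace joint_grade_topology.

Lemma inl_continuous (mu : logical_space -> {i01 R}) :
  fuzzy_open mu -> @fuzzy_open R B (mu \o inl).
Proof. by case=> alpha <-; exact: (open_funP (semantics B alpha)). Qed.

Lemma inr_continuous (mu : logical_space -> {i01 R}) :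
  fuzzy_open mu -> @fuzzy_open R B1 (mu \o inr).
Proof. by case=> alpha <-; exact: (open_funP (semantics B1 alpha)). Qed.

Let Z : sober_space R := sobrification logical_space.

Definition theory_l : fuzzy_hom B Z :=
  hom_comp (unit_hom logical_space) (@FuzzyHom R B logical_space _ inl_continuous).

Definition theory_r : fuzzy_hom B1 Z :=
  hom_comp (unit_hom logical_space) (@FuzzyHom R B1 logical_space _ inr_continuous).

(** A point of [Z] is determined by its values on the opens of the logical space, and these are all
    grades of formulas. *)
Lemma theory_eq (b : B) (b1 : B1) :
  modally_equivalent Sigma b b1 -> theory_l b = theory_r b1.
Proof.
move=> bb1; apply: eq_exist; apply/funext => -[mu muo] /=.
by rewrite /point_eval /=; have [alpha <-] := muo; exact: bb1.
Qed.

Definition joint_transition (x : logical_space) : T Z :=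
  match x with
  | inl b => fmap T theory_l (transition B b)
  | inr b1 => fmap T theory_r (transition B1 b1)
  end.

Lemma joint_transition_continuous (nu : T Z -> {i01 R}) :
  characteristic Sigma ->
  fuzzy_open nu -> fuzzy_open (nu \o joint_transition).
Proof.
move=> /(_ Z) /subbasis_continuous; apply => _ [n [lambda [mu [lS ->]]]].
(* Each argument [mu i], pulled back along the unit, is the joint grade of a formula [a i]. The
   modal formula on these [a i] witnesses openness, by naturality of [lambda] along [theory_l] and
   [theory_r]. *)
have /choice [a aE] i : exists alpha,
    joint_grade alpha = mu i \o unit_hom logical_space.
  have [alpha <-] := hom_continuous (unit_hom logical_space) (open_funP (mu i)).
  by exists alpha.
have al i : semantics B (a i) = pullback theory_l (mu i).
  by apply: open_funI; apply/funext => b; exact: (congr1 (@^~ (inl b)) (aE i)).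
have ar i : semantics B1 (a i) = pullback theory_r (mu i).
  by apply: open_funI; apply/funext => b; exact: (congr1 (@^~ (inr b)) (aE i)).
exists (FModal lS a); apply/funext => -[b|b1] /=; rewrite /grade /=.
- by rewrite (funext al) (lifting_natural lambda theory_l).
- by rewrite (funext ar) (lifting_natural lambda theory_r).
Qed.

Definition logical_valuation (p : Phi) : opens Z :=
  frame_open (@MkOpen R logical_space _ (ex_intro _ (FVar Sigma p) erefl)).

End LogicalSpace.

Theorem theorem4p12 (R : realType) (T : endofunctor R) (Sigma : signature T)
    (Phi : Type) (B B1 : fuzzy_model T Phi) (b : B) (b1 : B1) :
  characteristic Sigma ->
  modally_equivalent Sigma b b1 ->
  behaviourally_equivalent b b1.
Proof.
move=> char bb1.
pose tr := @FuzzyHom R (logical_space Sigma B B1) _ _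
  (fun nu => @joint_transition_continuous R T Sigma Phi B B1 nu char).
have [zeta zetaE] := sobrification_lift tr.
pose C := @FuzzyModel R T Phi _ zeta (@logical_valuation R T Sigma Phi B B1).
(* Both theory maps factor through the unit, where [zeta] agrees with [tr]; this gives the two
   transition squares. *)
have trE x : zeta (unit_hom _ x) = tr x by rewrite -zetaE.
have gT : hom_comp (fmap T (theory_l Sigma B B1)) (transition B)
    = hom_comp (transition C) (theory_l Sigma B B1).
  by apply: hom_funI; apply/funext => x; rewrite /= (trE (inl x)).
have hT : hom_comp (fmap T (theory_r Sigma B B1)) (transition B1)
    = hom_comp (transition C) (theory_r Sigma B B1).
  by apply: hom_funI; apply/funext => x; rewrite /= (trE (inr x)).
have gV p : pullback (theory_l Sigma B B1) (valuation C p) = valuation B p.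
  exact: open_funI.
have hV p : pullback (theory_r Sigma B B1) (valuation C p) = valuation B1 p.
  exact: open_funI.
exists C, (@ModelHom R T Phi B C _ gT gV), (@ModelHom R T Phi B1 C _ hT hV).
exact: theory_eq.
Qed.
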